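(* Let $M\ge N$ and let $X$ be an $N\times N$ real symmetric positive definite matrix with $\mathrm{Tr}(X^{-1})=N$. Then there exists a unit norm frame $\Phi=\{\varphi_i\}_{i=1}^M$ for $\mathbb{R}^N$ whose minimal ellipsoid is $E(X)$.
   Context: A sequence $\Phi=\{\varphi_i\}_{i=1}^M\subset\mathbb{R}^N$ is a frame if there are $0<A\le B<\infty$ with $A\|x\|^2\le\sum_{i=1}^M|\langle x,\varphi_i\rangle|^2\le B\|x\|^2$ for all $x\in\mathbb{R}^N$; it is unit norm if $\|\varphi_i\|_2=1$ for all $i$. For a positive definite $N\times N$ matrix $X$ and $c\in\mathbb{R}^N$, $E(X,c)=\{v\in\mathbb{R}^N:\langle X(v-c),v-c\rangle\le 1\}$ is an ellipsoid with center $c$, and $E(X)=E(X,0)$. The minimal ellipsoid of $\Phi$ is the unique ellipsoid of minimal volume containing the convex hull of $\{\varphi_i\}_{i=1}^M\cup\{-\varphi_i\}_{i=1}^M$. *)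

(* Defs.v *)
From HB Require Import structures.
From mathcomp Require Import all_boot all_order all_algebra.
From mathcomp Require Import all_classical all_reals all_analysis.

Set Implicit Arguments.
Unset Strict Implicit.
Unset Printing Implicit Defensive.

Import Order.TTheory GRing.Theory Num.Theory.

Local Open Scope classical_set_scope.
Local Open Scope ring_scope.

(* The norm that the library puts on matrices is the sup norm, hence the
   explicit Euclidean structure below. *)
Definition dotv (R : realType) (N : nat) (x y : 'cV[R]_N) : R :=
  \sum_(i < N) x i 0 * y i 0.

Definition norm2 (R : realType) (N : nat) (x : 'cV[R]_N) : R :=
  Num.sqrt (dotv x x).

Definition frame (R : realType) (N M : nat) (Phi : 'I_M -> 'cV[R]_N) : Prop :=
  exists A B : R, [/\ 0 < A, A <= B & forall x : 'cV[R]_N,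
    A * norm2 x ^+ 2 <= \sum_(i < M) `|dotv x (Phi i)| ^+ 2 <= B * norm2 x ^+ 2].

Definition unit_norm (R : realType) (N M : nat) (Phi : 'I_M -> 'cV[R]_N) : Prop :=
  forall i, norm2 (Phi i) = 1.

Definition posdefmx (R : realType) (N : nat) (X : 'M[R]_N) : Prop :=
  X^T = X /\ forall v : 'cV[R]_N, v != 0 -> 0 < dotv (X *m v) v.

Definition ellipsoid (R : realType) (N : nat) (X : 'M[R]_N) (c : 'cV[R]_N) :
    set 'cV[R]_N :=
  [set v | dotv (X *m (v - c)) (v - c) <= 1].

(* N-dimensional Lebesgue measure is the N-fold product of the library's
   one-dimensional [lebesgue_measure], carried by the iterated product type
   R * (R * ( ... * unit)); [col_of_prod] identifies this type with 'cV[R]_N.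
   [sigma_finite_prod] is the library's product measure under a new name: the
   library attaches to [product_measure1] itself only the sigma-finite structure
   of products of subprobabilities. *)
Section sigma_finite_prod.
Context (R : realType) (d1 d2 : measure_display)
  (T1 : measurableType d1) (T2 : measurableType d2)
  (m1 : {sigma_finite_measure set T1 -> \bar R})
  (m2 : {sigma_finite_measure set T2 -> \bar R}).

Definition sigma_finite_prod : set (T1 * T2) -> \bar R := product_measure1 m1 m2.

HB.instance Definition _ := Measure.on sigma_finite_prod.

Let sigma_finite_prodT : sigma_finite setT sigma_finite_prod.
Proof.
have /sigma_finiteP[F [TF ndF Foo]] := sigma_finiteT m1.
have /sigma_finiteP[G [TG ndG Goo]] := sigma_finiteT m2.
exists (fun n => F n `*` G n).
  rewrite -setXTT TF TG predeqE => -[x y]; split; last first.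
    by move=> [n _ []/= ? ?]; split; exists n.
  move=> [/= [n _ Fnx] [k _ Gky]]; exists (maxn n k) => //; split.
  - by move: x Fnx; exact/subsetPset/ndF/leq_maxl.
  - by move: y Gky; exact/subsetPset/ndG/leq_maxr.
move=> k; have [? ?] := Foo k; have [? ?] := Goo k.
split; first exact: measurableX.
by rewrite /sigma_finite_prod product_measure1E// lte_mul_pinfty// ge0_fin_numE.
Qed.

HB.instance Definition _ :=
  Measure_isSigmaFinite.Build _ _ _ sigma_finite_prod sigma_finite_prodT.

End sigma_finite_prod.

Record sigma_finite_space (R : realType) := SigmaFiniteSpace {
  sfs_display : measure_display;
  sfs_carrier : measurableType sfs_display;
  sfs_measure : {sigma_finite_measure set sfs_carrier -> \bar R} }.

Fixpoint lebesgue_space (R : realType) (N : nat) : sigma_finite_space R :=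
  if N is n.+1 then
    SigmaFiniteSpace
      (sigma_finite_prod (@lebesgue_measure R) (sfs_measure (lebesgue_space R n)))
  else SigmaFiniteSpace (@dirac _ unit tt R).

Fixpoint col_of_prod (R : realType) (N : nat) :
    sfs_carrier (lebesgue_space R N) -> 'cV[R]_N :=
  match N return sfs_carrier (lebesgue_space R N) -> 'cV[R]_N with
  | 0%N => fun=> 0
  | n.+1 => fun p => col_mx (p.1 : R)%:M (col_of_prod p.2)
  end.

Definition volume (R : realType) (N : nat) (A : set 'cV[R]_N) : \bar R :=
  sfs_measure (lebesgue_space R N) (@col_of_prod R N @^-1` A).

Definition convex_hull (R : realType) (N : nat) (S : set 'cV[R]_N) :
    set 'cV[R]_N :=
  smallest (@convex_set R 'cV[R]_N) S.

Definition sym_points (R : realType) (N M : nat) (Phi : 'I_M -> 'cV[R]_N) :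
    set 'cV[R]_N :=
  range Phi `|` range (fun i => - Phi i).

Definition covering_ellipsoid (R : realType) (N M : nat)
    (Phi : 'I_M -> 'cV[R]_N) (E : set 'cV[R]_N) : Prop :=
  (exists (X : 'M[R]_N) (c : 'cV[R]_N), posdefmx X /\ E = ellipsoid X c) /\
  convex_hull (sym_points Phi) `<=` E.

Definition min_volume_ellipsoid (R : realType) (N M : nat)
    (Phi : 'I_M -> 'cV[R]_N) (E : set 'cV[R]_N) : Prop :=
  covering_ellipsoid Phi E /\
  forall F, covering_ellipsoid Phi F -> (volume E <= volume F)%E.

Definition is_minimal_ellipsoid (R : realType) (N M : nat)
    (Phi : 'I_M -> 'cV[R]_N) (E : set 'cV[R]_N) : Prop :=
  min_volume_ellipsoid Phi E /\
  forall F, min_volume_ellipsoid Phi F -> F = E.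

(* Main.v *)
Require Import Defs.
From mathcomp Require Import all_boot all_order all_algebra.
From mathcomp Require Import all_classical all_reals all_analysis.
From mathcomp Require Import measurable_realfun ring lra.

(** Write S = X^-1, of trace N.  Any square P with P P^T = S satisfies
    P^T X P = 1, so its columns are an orthonormal basis for the form of X; in
    particular they lie on the boundary of E(X).  The squared lengths of the
    columns add up to tr S = N.  P may be replaced by P Q with Q orthogonal, and
    plane rotations turn all columns into unit vectors, one after the other
    ([posdefmx_orthonormal_basis], [unit_norm_columns]).  These N columns, with
    repetitions to reach M vectors, are the frame Phi.

    For minimality, let E(Y, c) cover the points phi_j and -phi_j.  Averaging
    the two conditions gives q_Y(phi_j) + q_Y(c) <= 1; summing over j, the matrix
    Z = P^T Y P has tr Z <= N (1 - q_Y(c)).  The inequality of arithmetic and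
    geometric means ([posdefmx_det_lt_expR_tr]) yields det Y <= det X, with
    equality only for Y = X and c = 0 ([ellipsoid_rigidity]).  This is the easy
    direction of John's theorem, for the decomposition of X^-1 as the sum of the
    phi_j phi_j^T.

    Volumes enter only through vol E(Y, c) = vol(unit ball) / sqrt (det Y), with
    a ball of positive finite volume ([volume_sublevel]).  Since the Lebesgue
    measure on R^N is an iterated product, this is proved by slicing along the
    first coordinate, where completing the square ([posdefmx_schur]) exhibits
    each slice as a lower-dimensional ellipsoid. *)

Import Order.TTheory GRing.Theory Num.Theory.
Local Open Scope classical_set_scope.
Local Open Scope ring_scope.

Set Implicit Arguments.
Unset Strict Implicit.
Unset Printing Implicit Defensive.

(** * The Euclidean inner product *)

Lemma dotvE (R : realType) n (x y : 'cV[R]_n) : dotv x y = (x^T *m y) 0 0.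
Proof. by rewrite mxE; apply: eq_bigr => i _; rewrite mxE. Qed.

Lemma dotvC (R : realType) n (x y : 'cV[R]_n) : dotv x y = dotv y x.
Proof. by apply: eq_bigr => i _; rewrite mulrC. Qed.

Lemma dotvDl (R : realType) n (x y z : 'cV[R]_n) :
  dotv (x + y) z = dotv x z + dotv y z.
Proof. by rewrite !dotvE linearD mulmxDl mxE. Qed.

Lemma dotvZl (R : realType) n a (x y : 'cV[R]_n) :
  dotv (a *: x) y = a * dotv x y.
Proof. by rewrite !dotvE linearZ -scalemxAl mxE. Qed.

Lemma dotvNl (R : realType) n (x y : 'cV[R]_n) : dotv (- x) y = - dotv x y.
Proof. by rewrite -scaleN1r dotvZl mulN1r. Qed.

Lemma dotvDr (R : realType) n (x y z : 'cV[R]_n) :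
  dotv z (x + y) = dotv z x + dotv z y.
Proof. by rewrite !(dotvC z) dotvDl. Qed.

Lemma dotvZr (R : realType) n a (x y : 'cV[R]_n) :
  dotv y (a *: x) = a * dotv y x.
Proof. by rewrite !(dotvC y) dotvZl. Qed.

Lemma dotvNr (R : realType) n (x y : 'cV[R]_n) : dotv y (- x) = - dotv y x.
Proof. by rewrite !(dotvC y) dotvNl. Qed.

Definition dotv_linear := (dotvDl, dotvDr, dotvZl, dotvZr, dotvNl, dotvNr).

Lemma dotv_ge0 (R : realType) n (x : 'cV[R]_n) : 0 <= dotv x x.
Proof. by apply: sumr_ge0 => i _; rewrite -expr2 sqr_ge0. Qed.

Lemma dotv_eq0 (R : realType) n (x : 'cV[R]_n) : (dotv x x == 0) = (x == 0).
Proof.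
rewrite psumr_eq0; last by move=> i _; rewrite -expr2 sqr_ge0.
apply/allP/eqP => [x0|-> i _]; last by rewrite mxE mul0r eqxx.
apply/colP => i; rewrite mxE.
by have /= := x0 i (mem_index_enum i); rewrite mulf_eq0 orbb => /eqP.
Qed.

Lemma norm2_sqr (R : realType) n (x : 'cV[R]_n) : norm2 x ^+ 2 = dotv x x.
Proof. by rewrite sqr_sqrtr // dotv_ge0. Qed.

Lemma dotv_mull (R : realType) m n (A : 'M[R]_(m, n)) x y :
  dotv (A *m x) y = dotv x (A^T *m y).
Proof. by rewrite !dotvE trmx_mul mulmxA. Qed.

Lemma dotv_congr (R : realType) m n (A : 'M[R]_m) (U : 'M[R]_(m, n)) v :
  dotv (U^T *m A *m U *m v) v = dotv (A *m (U *m v)) (U *m v).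
Proof. by rewrite -!mulmxA dotv_mull trmxK. Qed.

Lemma dotv_col_mx (R : realType) m n (a c : 'cV[R]_m) (b d : 'cV[R]_n) :
  dotv (col_mx a b) (col_mx c d) = dotv a c + dotv b d.
Proof. by rewrite !dotvE tr_col_mx mul_row_col mxE. Qed.

Lemma dotv_cons (R : realType) n (t : R) (u : 'cV[R]_n) :
  dotv (col_mx t%:M u) (col_mx t%:M u) = t ^+ 2 + dotv u u.
Proof. by rewrite dotv_col_mx [X in X + _]/dotv big_ord1 !mxE mulr1n. Qed.

Lemma dotv_col (R : realType) m n p (A : 'M[R]_(m, n)) (B : 'M[R]_(m, p)) i j :
  dotv (col i A) (col j B) = (A^T *m B) i j.
Proof. by rewrite mxE; apply: eq_bigr => k _; rewrite !mxE. Qed.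

Lemma cauchy_schwarz_dotv (R : realType) n (x y : 'cV[R]_n) :
  dotv x y ^+ 2 <= dotv x x * dotv y y.
Proof.
have [/eqP|y0] := eqVneq (dotv y y) 0.
  rewrite dotv_eq0 => /eqP ->; have E z : dotv z (0 : 'cV[R]_n) = 0.
    by rewrite -(scale0r 0) dotvZr mul0r.
  by rewrite !E expr0n mulr0.
have ypos : 0 < dotv y y by rewrite lt_neqAle eq_sym y0 dotv_ge0.
have := dotv_ge0 (dotv y y *: x - dotv x y *: y).
rewrite !dotv_linear (dotvC y x) => H.
rewrite -subr_ge0 -(pmulr_rge0 _ ypos); apply: le_trans H _.
by lra.
Qed.

(** * Positive definite matrices and Schur complements *)

Lemma posdefmx_unit (R : realType) n (A : 'M[R]_n) : posdefmx A -> A \in unitmx.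
Proof.
move=> [As Ap]; rewrite unitmxE unitfE; apply/det0P => -[v v0 vA].
have /Ap : v^T != 0 by rewrite -trmx0 (inj_eq trmx_inj).
rewrite -{1}As -trmx_mul vA trmx0 -(scale0r (v^T)) dotvZl mul0r.
by rewrite ltxx.
Qed.

Lemma posdefmx_ge0 (R : realType) n (A : 'M[R]_n) v :
  posdefmx A -> 0 <= dotv (A *m v) v.
Proof.
move=> [_ Ap]; have [->|/Ap/ltW//] := eqVneq v 0.
by rewrite -(scale0r (0 : 'cV[R]_n)) dotvZr mul0r.
Qed.

Lemma posdefmx_congr (R : realType) n (A U : 'M[R]_n) :
  posdefmx A -> U \in unitmx -> posdefmx (U^T *m A *m U).
Proof.
move=> [As Ap] uU; split; first by rewrite !trmx_mul trmxK As mulmxA.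
move=> v v0; rewrite dotv_congr Ap //; apply: contra v0 => /eqP Uv0.
by rewrite -(mulKmx uU v) Uv0 mulmx0.
Qed.

(** The unipotent lower triangular matrix (t, u) |-> (t, u + t w) by which
    completing the square in the first coordinate changes variables. *)
Definition shear (R : realType) n (w : 'cV[R]_n) : 'M[R]_(1 + n) :=
  block_mx 1%:M 0 w 1%:M.

Lemma det_shear (R : realType) n (w : 'cV[R]_n) : \det (shear w) = 1.
Proof. by rewrite det_lblock !det1 mulr1. Qed.

Lemma mul_shear_col (R : realType) n (w u : 'cV[R]_n) t :
  shear w *m col_mx t%:M u = col_mx t%:M (u + t *: w).
Proof.
by rewrite mul_block_col !mul1mx mul0mx addr0 mul_mx_scalar [in LHS]addrC.
Qed.

Lemma dotv_block_diag (R : realType) n (s t : R) (D : 'M[R]_n) u :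
  dotv (block_mx s%:M 0 0 D *m col_mx t%:M u) (col_mx t%:M u)
  = s * t ^+ 2 + dotv (D *m u) u.
Proof.
rewrite mul_block_col !mul0mx addr0 add0r dotv_col_mx -scalar_mxM.
by rewrite /dotv big_ord1 !mxE !mulr1n; ring.
Qed.

(** Completing the square: q(t, u) = s t^2 + q'(u + t w), where q' is the
    restriction of q to the hyperplane t = 0, s is the Schur complement and w
    solves (D' w = lower left block of D).  Every induction on the dimension
    below peels off the first coordinate this way, which is also how the
    Lebesgue measure on R^(n+1) is built from the one on R^n. *)
Lemma posdefmx_schur (R : realType) n (D : 'M[R]_(1 + n)) : posdefmx D ->
  exists s w, [/\ 0 < s, posdefmx (drsubmx D) &
    D = (shear w)^T *m block_mx s%:M 0 0 (drsubmx D) *m shear w].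
Proof.
move=> [Ds Dp].
have Dr : posdefmx (drsubmx D).
  split; first by rewrite trmx_drsub Ds.
  move=> u u0; have /Dp : col_mx (0 : 'cV[R]_1) u != 0.
    by rewrite -col_mx0; apply: contra u0 => /eqP/eq_col_mx[_ ->].
  by rewrite -{1}(submxK D) mul_block_col !mulmx0 !add0r dotv_col_mx
     dotvC -(scale0r (0:'cV[R]_1)) dotvZl mul0r add0r.
set D' := drsubmx D in Dr *.
pose w := invmx D' *m dlsubmx D.
have wE : D' *m w = dlsubmx D by rewrite mulKVmx // posdefmx_unit.
pose s := (ulsubmx D - w^T *m D' *m w) 0 0.
have DE : D = (shear w)^T *m block_mx s%:M 0 0 D' *m shear w.
  rewrite tr_block_mx !trmx1 trmx0 !mulmx_block !mul1mx !mul0mx !mulmx0.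
  rewrite !mulmx1 !addr0 !add0r wE -{1}(submxK D); congr block_mx.
    by rewrite -mx11_scalar -mulmxA wE subrK.
  by rewrite -{1}Ds -trmx_dlsub -wE trmx_mul Dr.1.
exists s, w; split => //.
have /Dp : col_mx 1%:M (- w) != 0 :> 'cV[R]_(1 + n).
  rewrite -col_mx0; apply/eqP => /eq_col_mx[/matrixP /(_ 0 0)].
  by rewrite !mxE /= => /eqP; rewrite oner_eq0.
rewrite {1}DE dotv_congr mul_shear_col scale1r addNr dotv_block_diag.
by rewrite mulmx0 expr1n mulr1 -(scale0r (0 : 'cV[R]_n)) dotvZr mul0r addr0.
Qed.

Lemma det_schur (R : realType) n (D' : 'M[R]_n) s w :
  \det ((shear w)^T *m block_mx s%:M 0 0 D' *m shear w) = s * \det D'.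
Proof.
by rewrite !det_mulmx det_tr det_shear mul1r mulr1 det_ublock det_scalar1.
Qed.

Lemma mxtrace_schur (R : realType) n (D' : 'M[R]_n) s w : D'^T = D' ->
  \tr ((shear w)^T *m block_mx s%:M 0 0 D' *m shear w)
  = s + dotv (D' *m w) w + \tr D'.
Proof.
move=> Ds; rewrite tr_block_mx !trmx1 trmx0 !mulmx_block !mul1mx !mul0mx.
rewrite !mulmx0 !mulmx1 !addr0 !add0r mxtrace_block mxtraceD mxtrace_scalar.
by rewrite mulr1n dotv_mull dotvE Ds mulmxA /mxtrace big_ord1.
Qed.

Lemma posdefmx_det_gt0 (R : realType) n (D : 'M[R]_n) :
  posdefmx D -> 0 < \det D.
Proof.
elim: n D => [D _|n IH D /(@posdefmx_schur R n)[s [w [s0 /IH D'0 ->]]]].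
  by rewrite det_mx00.
by rewrite det_schur mulr_gt0.
Qed.

(** The columns of P are an orthonormal basis for the form of D; in an inverse
    Cholesky factorisation, P is lower triangular. *)
Lemma posdefmx_orthonormal_basis (R : realType) n (D : 'M[R]_n) :
  posdefmx D -> exists P : 'M[R]_n, P^T *m D *m P = 1%:M.
Proof.
elim: n D => [D _|n IH D /(@posdefmx_schur R n)[s [w [s0 /IH[P PDP] ->]]]].
  by exists 0; rewrite [LHS]flatmx0 [RHS]flatmx0.
suff [Q QDQ] : exists Q : 'M[R]_(1 + n), Q^T *m ((shear w)^T *m
  block_mx s%:M 0 0 (@drsubmx R 1 n 1 n D) *m shear w) *m Q = 1%:M by exists Q.
exists (shear (- w) *m block_mx ((Num.sqrt s)^-1%:M) 0 0 P : 'M[R]_(1 + n)).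
rewrite trmx_mul !mulmxA -(mulmxA _ _ (shear w)^T) -trmx_mul.
rewrite -(mulmxA _ (shear w)).
have -> : shear w *m shear (- w) = 1%:M.
  rewrite mulmx_block !mul1mx !mul0mx !mulmx0 !mulmx1 !addr0 add0r subrr.
  by rewrite -scalar_mx_block.
rewrite trmx1 !mulmx1 tr_block_mx !trmx0 tr_scalar_mx !mulmx_block.
rewrite !mul0mx !mulmx0 !addr0 !mul0mx !add0r PDP -!scalar_mxM.
have -> : (Num.sqrt s)^-1 * s * (Num.sqrt s)^-1 = 1.
  have sq0 : Num.sqrt s != 0 by rewrite gt_eqF // sqrtr_gt0.
  by rewrite -{2}(sqr_sqrtr (ltW s0)); field.
by rewrite -scalar_mx_block.
Qed.

(** The inequality of arithmetic and geometric means for the eigenvalues, with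
    its equality case, in a form that needs no eigenvalues: by completing the
    square, det D = s * det D' and tr D = s + q'(w) + tr D', so the claim for D
    follows from the one for D' and from s <= exp (s - 1).  Equality forces
    s = 1, w = 0 and D' = 1. *)
Lemma posdefmx_det_lt_expR_tr (R : realType) n (D : 'M[R]_n) :
  posdefmx D -> D != 1%:M -> \det D < expR (\tr D - n%:R).
Proof.
move=> Dp D1.
suff [|//] : D = 1%:M \/ \det D < expR (\tr D - n%:R).
  by move=> E; rewrite E eqxx in D1.
elim: n D Dp {D1} => [D _|n IH D /(@posdefmx_schur R n)[s [w [s0 Dp DE]]]].
  by left; rewrite [LHS]flatmx0 [RHS]flatmx0.
move: DE Dp; set D' : 'M[R]_n := drsubmx _ => DE Dp.
have -> : \det D = s * \det D' by rewrite DE det_schur.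
have -> : \tr D = s + dotv (D' *m w) w + \tr D'.
  by rewrite DE mxtrace_schur // Dp.1.
have q0 := posdefmx_ge0 w Dp; have d0 := posdefmx_det_gt0 Dp.
have sE : s <= expR (s - 1) by have := expR_ge1Dx (s - 1); rewrite addrC subrK.
(* Each factor on the left is bounded by one on the right; a single strict
   inequality among the three makes the products differ. *)
have step a b c : s <= a -> \det D' <= b -> 1 <= c -> 
    (s < a \/ \det D' < b \/ 1 < c) -> s * \det D' < a * b * c.
  move=> sa Db c1 H.
  have ab : s * \det D' <= a * b by rewrite ler_pM // ltW.
  have ab0 : 0 < s * \det D' by rewrite mulr_gt0.
  case: H => [H|[H|H]].
  - apply: (@lt_le_trans _ _ (a * b)); last by rewrite ler_peMr //; lra.
    apply: (@lt_le_trans _ _ (a * \det D')); first by rewrite ltr_pM2r.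
    by rewrite ler_pM2l //; lra.
  - apply: (@lt_le_trans _ _ (a * b)); last by rewrite ler_peMr //; lra.
    apply: (@lt_le_trans _ _ (s * b)); first by rewrite ltr_pM2l.
    by rewrite ler_pM2r //; lra.
  - by apply: (le_lt_trans ab); rewrite ltr_pMr //; lra.
have -> : s + dotv (D' *m w) w + \tr D' - n.+1%:R
    = (s - 1) + (\tr D' - n%:R) + dotv (D' *m w) w by rewrite -natr1; ring.
rewrite [expR (s - 1 + _ + _)]expRD [expR (s - 1 + _)]expRD.
have Db : \det D' <= expR (\tr D' - n%:R).
  by case: (IH _ Dp) => [->|/ltW //]; rewrite det1 mxtrace1 subrr expR0.
have c1 : 1 <= expR (dotv (D' *m w) w) by rewrite -expR0 ler_expR.
have [s1|s1] := eqVneq s 1; last first.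
  right; apply: step => //; left.
  by have := @expR_gt1Dx R (s - 1); rewrite subr_eq0 addrC subrK; exact.
have [w0|w0] := eqVneq w 0; last first.
  by right; apply: step => //; right; right; rewrite expR_gt1 Dp.2.
case: (IH _ Dp) => [D1|D1]; last by right; apply: step => //; right; left.
left; rewrite DE D1 s1 w0 -scalar_mx_block mulmx1.
by rewrite /shear -scalar_mx_block trmx1 mulmx1.
Qed.

(** * Volumes of ellipsoids *)

(** The image of the Lebesgue measure under x |-> a (x - c), scaled by a, agrees
    with the Lebesgue measure on half-open intervals, hence is equal to it. *)
Lemma ge0_integral_lebesgue_affine (R : realType) (a c : R)
    (f : R -> \bar R) :
  0 < a -> measurable_fun setT f -> (forall x, 0 <= f x)%E ->
  (\int[lebesgue_measure]_x f (a * (x - c))%R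
   = (a^-1)%:E * \int[lebesgue_measure]_x f x)%E.
Proof.
move=> a0 mf f0.
pose phi : R -> measurableTypeR R := fun x => a * (x - c).
have mphi : measurable_fun setT phi.
  by apply: measurable_funM => //; apply: measurable_funB.
pose a' : {nonneg R} := NngNum (ltW a0).
pose nu : {measure set (measurableTypeR R) -> \bar R} :=
  mscale a'
    (measure_function_pushforward__canonical__measure_function_Measure
       lebesgue_measure mphi).
have nuE A : measurable A -> lebesgue_measure A = nu A.
  apply: lebesgue_measure_unique => _ [[l r] _ <-] /=.
  rewrite /nu /= /mscale /= /pushforward.
  have -> : phi @^-1` `]l, r] = `](l / a + c), (r / a + c)]%classic.
    apply/seteqP; split => x /=; rewrite !in_itv /= /phi;
      rewrite -ltrBrDr -lerBlDr ltr_pdivrMr // ler_pdivlMr //;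
      rewrite ![a * _]mulrC; exact.
  rewrite !lebesgue_measure_itv /= !lte_fin ltrD2r ltr_pM2r ?invr_gt0 //.
  case: ifP => _; last by rewrite mule0.
  by rewrite -!EFinD -EFinM; congr _%:E; have := lt0r_neq0 a0 => ?; field.
have E : (\int[lebesgue_measure]_x f x
    = a%:E * \int[lebesgue_measure]_x f (phi x))%E.
  rewrite (eq_measure_integral nu); last by move=> A mA _; exact: nuE.
  rewrite ge0_integral_mscale //=; congr (_ * _)%E.
  by rewrite ge0_integral_pushforward.
by rewrite E muleA -EFinM mulVf ?gt_eqF // mul1e.
Qed.

Lemma measurable_col_of_prod (R : realType) n (i : 'I_n) :
  measurable_fun setT (fun p : sfs_carrier (lebesgue_space R n) =>
    col_of_prod p i 0).
Proof.
elim: n i => [[]//|n IH] i.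
case: (split_ordP (i : 'I_(1 + n))) => j ->.
  rewrite [X in measurable_fun _ X](_ : _ = fst); first exact: measurable_fst.
  by apply/funext => p; apply: etrans (col_mxEu _ _ _ _) _; rewrite !mxE ord1.
rewrite [X in measurable_fun _ X](_ : _ =
    (fun q => col_of_prod q j 0) \o snd).
  by apply: measurableT_comp; [exact: IH|exact: measurable_snd].
by apply/funext => p; exact: etrans (col_mxEd _ _ _ _) _.
Qed.

(** Cavalieri's principle along the first coordinate. *)
Lemma volumeS (R : realType) n (A : set 'cV[R]_(1 + n)) :
  volume A = (\int[lebesgue_measure]_x volume [set u | A (col_mx x%:M u)])%E.
Proof.
apply: eq_integral => x _ /=; congr (sfs_measure _ _).
by apply/seteqP; split => y; rewrite /xsection /= inE.
Qed.

Lemma measurable_volume_section (R : realType) n (A : set 'cV[R]_(1 + n)) :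
  measurable (@col_of_prod R n.+1 @^-1` A) ->
  measurable_fun setT (fun x : R => volume [set u | A (col_mx x%:M u)]).
Proof.
move=> mA.
have := measurable_fun_xsection (sfs_measure (lebesgue_space R n)) mA.
rewrite [X in measurable_fun _ X -> _](_ : _ =
  (fun x : R => volume [set u | A (col_mx x%:M u)])) //.
apply/funext => x /=; congr (sfs_measure _ _).
by apply/seteqP; split => y; rewrite /xsection /= inE.
Qed.

(** [ellipsoid D c] is [sublevel D c 1]; the level r varies because slicing an
    ellipsoid lowers it. *)
Definition sublevel (R : realType) n (D : 'M[R]_n) (c : 'cV[R]_n) (r : R) :
  set 'cV[R]_n := [set v | dotv (D *m (v - c)) (v - c) <= r].

(** Parametrised by the square r of the radius, and empty for r < 0, so that
    its slices are again of this form. *)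
Definition euclidean_ball (R : realType) n (r : R) : set 'cV[R]_n :=
  [set v | dotv v v <= r].

Lemma measurable_sublevel (R : realType) n (D : 'M[R]_n) c r :
  measurable (@col_of_prod R n @^-1` sublevel D c r).
Proof.
have mc i : measurable_fun setT (fun p => (@col_of_prod R n p - c) i 0).
  apply: (eq_measurable_fun (fun p => col_of_prod p i 0 - c i 0)).
    by move=> p _; rewrite !mxE.
  by apply: measurable_funB => //; exact: measurable_col_of_prod.
have mq : measurable_fun setT (fun p =>
    dotv (D *m (@col_of_prod R n p - c)) (@col_of_prod R n p - c)).
  apply: measurable_sum => i; apply: measurable_funM => //.
  apply: (eq_measurable_fun
    (fun p => \sum_j D i j * (@col_of_prod R n p - c) j 0)).
    by move=> p _; rewrite [in RHS]mxE.
  by apply: measurable_sum => j; apply: measurable_funM.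
rewrite [X in measurable X](_ : _ = setT `&` (fun p =>
    dotv (D *m (@col_of_prod R n p - c)) (@col_of_prod R n p - c))
    @^-1` `]-oo, r]); first exact: mq.
by rewrite setTI; apply/seteqP; split => p; rewrite /= in_itv.
Qed.

Lemma euclidean_ballE (R : realType) n r :
  @euclidean_ball R n r = sublevel 1%:M 0 r.
Proof. by apply/seteqP; split => v; rewrite /sublevel /= subr0 mul1mx. Qed.

Lemma measurable_euclidean_ball (R : realType) n r :
  measurable (@col_of_prod R n @^-1` @euclidean_ball R n r).
Proof. by rewrite euclidean_ballE; exact: measurable_sublevel. Qed.

Lemma euclidean_ball_slice (R : realType) n (r x : R) :
  [set u : 'cV[R]_n | @euclidean_ball R (1 + n) r (col_mx x%:M u)]
  = euclidean_ball (r - x ^+ 2).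
Proof.
by apply/seteqP; split => v; rewrite /euclidean_ball /= dotv_cons lerBrDl.
Qed.

Lemma volume_euclidean_ballS (R : realType) n r :
  volume (@euclidean_ball R n.+1 r)
  = (\int[lebesgue_measure]_x volume (@euclidean_ball R n (r - x ^+ 2)))%E.
Proof.
rewrite (@volumeS R n); apply: eq_integral => x _; congr (volume _).
exact: euclidean_ball_slice.
Qed.

Lemma sublevel_slice (R : realType) n (D : 'M[R]_n) s w (c1 : R) c2 r x :
  0 <= s ->
  [set u | sublevel ((shear w)^T *m block_mx s%:M 0 0 D *m shear w)
    (col_mx c1%:M c2) r (col_mx x%:M u)]
  = sublevel D (c2 - (x - c1) *: w) (r - (Num.sqrt s * (x - c1)) ^+ 2).
Proof.
move=> s0; have xE : x%:M - c1%:M = (x - c1)%:M :> 'M[R]_1 by rewrite raddfB.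
apply/seteqP; split => u; rewrite /sublevel /= opp_col_mx add_col_mx xE;
rewrite dotv_congr mul_shear_col dotv_block_diag exprMn;
by rewrite sqr_sqrtr // opprB [_ *: w - c2]addrC addrA lerBrDl.
Qed.

(** Affine images scale volumes by the determinant; for ellipsoids this reduces
    to the one-dimensional change of variables.  After completing the square,
    the slice at first coordinate x is a translate of the sublevel set of D' at
    level r - s (x - c1)^2, of volume f (sqrt s * (x - c1)) / sqrt (det D'),
    where f is the slice volume of the ball.  Substituting in the integral over
    x produces the missing factor 1 / sqrt s, and s * det D' = det D. *)
Lemma volume_sublevel (R : realType) n (D : 'M[R]_n) c r : posdefmx D ->
  volume (sublevel D c r)
  = (((Num.sqrt (\det D))^-1)%:E * volume (@euclidean_ball R n r))%E.
Proof.
elim: n D c r => [D c r _|n IH D c r].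
  rewrite det_mx00 sqrtr1 invr1 mul1e; congr (volume _).
  by apply/seteqP; split => v; rewrite /sublevel /euclidean_ball /= /dotv
     !big_ord0.
move=> /(@posdefmx_schur R n)[s [w [s0]]].
set D' := drsubmx _ => Dp DE.
have d0 := posdefmx_det_gt0 Dp.
have mf : measurable_fun setT
    (fun x : R => volume (@euclidean_ball R n (r - x ^+ 2))).
  have := @measurable_volume_section R n _ (measurable_euclidean_ball n.+1 r).
  by apply: eq_measurable_fun => x _; rewrite euclidean_ball_slice.
pose c1 : R := @usubmx R 1 n 1 c 0 0.
pose c2 : 'cV[R]_n := @dsubmx R 1 n 1 c.
have cE : c = col_mx c1%:M c2 by rewrite -mx11_scalar vsubmxK.
have slice (x : R) : [set u : 'cV[R]_n | sublevel D c r (col_mx x%:M u)]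
    = sublevel D' (c2 - (x - c1) *: w) (r - (Num.sqrt s * (x - c1)) ^+ 2).
  by rewrite DE cE; exact/sublevel_slice/ltW.
rewrite (@volumeS R n).
under eq_integral do rewrite slice IH //.
pose f (x : R) := volume (@euclidean_ball R n (r - x ^+ 2)).
have f0 x : (0 <= f x)%E by exact: measure_ge0.
have maffine : measurable_fun setT (fun x : R => f (Num.sqrt s * (x - c1))).
  apply: measurableT_comp => //.
  by apply: measurable_funM => //; apply: measurable_funB.
rewrite ge0_integralZl //.
rewrite (@ge0_integral_lebesgue_affine R (Num.sqrt s) c1 f) ?sqrtr_gt0 //.
rewrite -volume_euclidean_ballS muleA -EFinM; congr ((_%:E) * _)%E.
by rewrite DE det_schur sqrtrM ?ltW // invfM mulrC.
Qed.

Lemma volume_cons_prod (R : realType) n (I : set R) (A : set 'cV[R]_n) :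
  measurable I -> measurable (@col_of_prod R n @^-1` A) ->
  sfs_measure (lebesgue_space R n.+1) (I `*` (@col_of_prod R n @^-1` A))
  = (lebesgue_measure I * volume A)%E.
Proof. by move=> mI mA; apply: product_measure1E. Qed.

(** The ball contains the product of an interval with a smaller ball. *)
Lemma volume_euclidean_ball_gt0 (R : realType) n (r : R) :
  0 < r -> (0 < volume (@euclidean_ball R n r))%E.
Proof.
elim: n r => [r r0|n IH r r0].
  rewrite /volume [X in sfs_measure _ X](_ : _ = setT) /=.
    by rewrite diracT.
  by apply/seteqP; split => // v _; rewrite /euclidean_ball /= /dotv big_ord0
     ltW.
have r20 : 0 < r / 2 by rewrite divr_gt0.
pose b := Num.sqrt (r / 2); have b0 : 0 < b by rewrite sqrtr_gt0.
pose C := `[- b, b]%classic `*` (@col_of_prod R n @^-1` euclidean_ball (r / 2)).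
have mb := measurable_euclidean_ball (R := R) n (r / 2).
have CE := volume_cons_prod (measurable_itv `[- b, b]) mb.
apply: (@lt_le_trans _ _ (sfs_measure (lebesgue_space R n.+1) C)).
  rewrite CE lebesgue_measure_itv /= lte_fin gtrN // mule_gt0 ?IH //.
  by rewrite -EFinD lte_fin opprK addr_gt0.
apply: le_measure; rewrite ?inE.
- exact: measurableX.
- exact: measurable_euclidean_ball.
move=> [x u] /= []; rewrite /= in_itv /= => /andP[bx xb] ub.
rewrite /euclidean_ball /= (@dotv_cons R n).
rewrite [leRHS](splitr r) lerD //.
by rewrite -(sqr_sqrtr (ltW r20)) -/b; nra.
Qed.

(** The ball is contained in the product of an interval with a ball. *)
Lemma volume_euclidean_ball_lty (R : realType) n (r : R) :
  0 <= r -> (volume (@euclidean_ball R n r) < +oo)%E.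
Proof.
move=> r0; elim: n => [|n IH].
  rewrite /volume [X in sfs_measure _ X](_ : _ = setT) /=.
    by rewrite diracT ltry.
  by apply/seteqP; split => // v _; rewrite /euclidean_ball /= /dotv big_ord0.
pose b := Num.sqrt r.
pose C := `[- b, b]%classic `*` (@col_of_prod R n @^-1` euclidean_ball r).
have mb := measurable_euclidean_ball (R := R) n r.
have CE := volume_cons_prod (measurable_itv `[- b, b]) mb.
apply: (@le_lt_trans _ _ (sfs_measure (lebesgue_space R n.+1) C)).
  apply: le_measure; rewrite ?inE.
  - exact: measurable_euclidean_ball.
  - exact: measurableX.
  move=> [x u] /=; rewrite /euclidean_ball /= (@dotv_cons R n) => xu.
  split => /=.
    rewrite in_itv /= -ler_norml -sqrtr_sqr ler_sqrt //.
    by apply: le_trans xu; rewrite lerDl dotv_ge0.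
  by rewrite /euclidean_ball /=; apply: le_trans xu; rewrite lerDr sqr_ge0.
by rewrite CE lte_mul_pinfty // lebesgue_measure_itv /=; case: ifP.
Qed.

(** * Normalising the columns of a factorisation *)

Lemma mxtrace_mul_tr (R : realType) m n (P : 'M[R]_(m, n)) :
  \tr (P *m P^T) = \sum_j dotv (col j P) (col j P).
Proof. by rewrite mxtrace_mulC; apply: eq_bigr => j _; rewrite dotv_col. Qed.

(** Rotating the pair of columns (i, j) leaves P P^T unchanged and moves the
    length of the i-th column continuously from below 1 to above 1, so that it
    takes the value 1 on the way. *)
Lemma rotate_columns (R : realType) m n (P : 'M[R]_(m, n)) i j :
  dotv (col i P) (col i P) < 1 -> 1 < dotv (col j P) (col j P) ->
  exists Q : 'M[R]_(m, n), [/\ Q *m Q^T = P *m P^T,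
    dotv (col i Q) (col i Q) = 1 &
    forall l, l != i -> l != j -> col l Q = col l P].
Proof.
set a := dotv (col i P) _; set c := dotv (col j P) _ => a1 c1.
have ij : j != i by apply/eqP => E; move: c1; rewrite /c E ltNge ltW.
pose b := dotv (col i P) (col j P).
(* t is the tangent of the rotation angle; the quadratic equation for it has
   positive discriminant because (1 - a) (c - 1) > 0. *)
have [t tE] : exists t, a + 2 * b * t + c * t ^+ 2 = 1 + t ^+ 2.
  pose d := Num.sqrt (b ^+ 2 + (1 - a) * (c - 1)).
  have dE : d ^+ 2 = b ^+ 2 + (1 - a) * (c - 1).
    by rewrite sqr_sqrtr // addr_ge0 ?sqr_ge0 // mulr_ge0 ?subr_ge0 ?ltW.
  have c0 : c - 1 != 0 by rewrite subr_eq0 gt_eqF.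
  exists ((d - b) / (c - 1)); apply/eqP; rewrite -subr_eq0; apply/eqP.
  transitivity ((d ^+ 2 - (b ^+ 2 + (1 - a) * (c - 1))) / (c - 1)).
    by field.
  by rewrite dE subrr mul0r.
pose u := (Num.sqrt (1 + t ^+ 2))^-1.
have uE : u ^+ 2 * (1 + t ^+ 2) = 1.
  have t0 : 0 < 1 + t ^+ 2 by rewrite ltr_wpDr ?sqr_ge0.
  by rewrite exprVn sqr_sqrtr ?ltW // mulVf // gt_eqF.
pose Q := \matrix_(k, l) if l == i then u * (P k i + t * P k j)
  else if l == j then u * (P k j - t * P k i) else P k l.
exists Q; split.
- apply/matrixP => k l; rewrite !mxE (bigD1 i) //= (bigD1 j) //=.
  rewrite [RHS](bigD1 i) //= [in RHS](bigD1 j) //= !addrA; congr (_ + _).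
    rewrite !mxE !eqxx (negbTE ij).
    by rewrite -[RHS]mul1r -uE; ring.
  apply: eq_bigr => x /andP[xi xj]; rewrite !mxE.
  by rewrite (negbTE xi) (negbTE xj).
- have -> : col i Q = u *: (col i P + t *: col j P).
    by apply/colP => k; rewrite !mxE eqxx.
  rewrite !dotv_linear (dotvC (col j P)) -/a -/b -/c -uE -tE; ring.
- by move=> l li lj; apply/colP => k; rewrite !mxE (negbTE li) (negbTE lj).
Qed.

(** If not all columns are unit vectors then, the mean squared length being 1,
    one is shorter than 1 and another is longer; a rotation makes the first of
    them a unit vector and creates no new exception other than the second. *)
Lemma unit_norm_columns (R : realType) m n (P : 'M[R]_(m, n)) :
  \tr (P *m P^T) = n%:R -> exists Q : 'M[R]_(m, n),
    Q *m Q^T = P *m P^T /\ forall j, dotv (col j Q) (col j Q) = 1.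
Proof.
have [k] := ubnP #|[pred j | dotv (col j P) (col j P) != 1]|.
elim: k P => // k IH P kP trP.
pose d j := dotv (col j P) (col j P).
have sum0 : \sum_j (d j - 1) = 0.
  by rewrite sumrB -mxtrace_mul_tr trP sumr_const card_ord subrr.
have [/forallP d1|] := boolP [forall j, d j == 1].
  by exists P; split => // j; exact/eqP/d1.
rewrite negb_forall => /existsP[l dl].
have [i di] : exists i, d i < 1.
  apply/existsP; apply: contraNT dl; rewrite negb_exists => /forallP d1.
  rewrite -subr_eq0; apply/eqP; apply: (psumr_eq0P _ sum0) => // j _.
  by rewrite subr_ge0 leNgt d1.
have [j dj] : exists j, 1 < d j.
  apply/existsP; apply: contraNT dl; rewrite negb_exists => /forallP d1.
  rewrite -subr_eq0 -oppr_eq0; apply/eqP.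
  have sum0' : \sum_j - (d j - 1) = 0 by rewrite sumrN sum0 oppr0.
  apply: (psumr_eq0P _ sum0') => // j _.
  by rewrite oppr_ge0 subr_le0 leNgt d1.
have [Q [QP Qi Ql]] := rotate_columns di dj.
have [| |Q' [Q'Q Q'1]] := IH Q; last by exists Q'; rewrite Q'Q QP.
- apply: (@leq_trans #|[pred l | d l != 1]|); last by rewrite -ltnS.
  apply: proper_card; apply/properP; split; last first.
    by exists i; rewrite !inE ?Qi ?eqxx // (lt_eqF di).
  apply/fintype.subsetP => x; rewrite !inE.
  have [->|xi] := eqVneq x i; first by rewrite Qi eqxx.
  have [->|xj] := eqVneq x j; first by rewrite (gt_eqF dj).
  by rewrite Ql.
- by rewrite QP.
Qed.

(** * Ellipsoids through the columns *)

(** The average of the two hypotheses, by the parallelogram identity. *)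
Lemma ellipsoid_pm (R : realType) n (Y : 'M[R]_n) c v :
  ellipsoid Y c v -> ellipsoid Y c (- v) ->
  dotv (Y *m v) v + dotv (Y *m c) c <= 1.
Proof.
rewrite /ellipsoid /= !mulmxBr mulmxN !dotv_linear => H1 H2.
by lra.
Qed.

(** Adding up [ellipsoid_pm] over the columns bounds the trace of Z = P^T Y P by
    n (1 - q_Y(c)) <= n, so det Z < 1 unless Z = 1, and det Z is det Y / det X.
    When Z = 1 its trace is n, which leaves no room for a nonzero centre. *)
Lemma ellipsoid_rigidity (R : realType) n (X Y P : 'M[R]_n) c :
  (0 < n)%N -> P^T *m X *m P = 1%:M -> posdefmx Y ->
  (forall j, ellipsoid Y c (col j P) /\ ellipsoid Y c (- col j P)) ->
  (Y = X /\ c = 0) \/ \det Y < \det X.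
Proof.
move=> n0 PXP Yp inE.
have uP : P \in unitmx.
  by have := mulmx1_unit PXP => -[_].
pose Z := P^T *m Y *m P.
have Zp : posdefmx Z by exact: posdefmx_congr.
have trZ : \tr Z + n%:R * dotv (Y *m c) c <= n%:R.
  have nE : n%:R = \sum_(j < n) (1 : R) by rewrite sumr_const card_ord.
  rewrite nE mulr_suml -big_split /=; apply: ler_sum => j _; rewrite mul1r.
  have [? ?] := inE j.
  rewrite (_ : Z j j = dotv (Y *m col j P) (col j P)) ?ellipsoid_pm //.
  have -> : Y *m col j P = col j (Y *m P) by rewrite !colE mulmxA.
  by rewrite dotvC dotv_col mulmxA.
have [Z1|Z1] := eqVneq Z 1%:M.
  left; split.
    have := congr1 (fun A => invmx P^T *m A *m invmx P) (etrans Z1 (esym PXP)).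
    by rewrite !mulmxA !mulVmx ?unitmx_tr // !mul1mx !mulmxK.
  apply/eqP; apply: contraTT trZ => c0.
  rewrite Z1 mxtrace1 -ltNge ltrDl mulr_gt0 ?ltr0n //; exact: Yp.2.
right; have := posdefmx_det_lt_expR_tr Zp Z1.
have -> : \det Z = \det P ^+ 2 * \det Y by rewrite !det_mulmx det_tr; ring.
have dX : \det P ^+ 2 * \det X = 1.
  by rewrite -(det1 R n) -PXP !det_mulmx det_tr; ring.
have dP : 0 < \det P ^+ 2.
  by rewrite lt_neqAle sqr_ge0 eq_sym sqrf_eq0 -unitfE -unitmxE uP.
move=> /lt_le_trans H; rewrite -(ltr_pM2l dP) dX; apply: H.
rewrite -[leRHS]expR0 ler_expR subr_le0; apply: (le_trans _ trZ).
by rewrite lerDl mulr_ge0 ?ler0n //; exact: posdefmx_ge0.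
Qed.

(** For the form q of X, t q(x) + (1 - t) q(y) - q(t x + (1 - t) y) is
    t (1 - t) q(x - y) >= 0. *)
Lemma convex_set_ellipsoid0 (R : realType) n (X : 'M[R]_n) :
  posdefmx X -> @convex_set R 'cV[R]_n (ellipsoid X 0).
Proof.
move=> Xp x y l; rewrite !inE /ellipsoid /= !subr0 => qx qy.
have -> : conv l (x : convex_lmodType _) y
  = l%:num *: x + (1 - l%:num) *: y by [].
have q0 := posdefmx_ge0 (x - y) Xp.
have l0 : 0 <= l%:num by [].
have l1 : l%:num <= 1 by [].
move: q0 (l%:num) l0 l1 => + t t0 t1.
rewrite !mulmxDr !mulmxN -!scalemxAr !dotv_linear => q0.
have : 0 <= t * (1 - t) by rewrite mulr_ge0 // subr_ge0.
nra.
Qed.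

Lemma ellipsoid0N (R : realType) n (X : 'M[R]_n) v :
  ellipsoid X 0 v -> ellipsoid X 0 (- v).
Proof. by rewrite /ellipsoid /= !subr0 mulmxN !dotv_linear opprK. Qed.

(** Among the ellipsoids that cover a family containing all the columns of P,
    E(X) is the strict minimiser of the volume, since the volume of E(Y, c) is
    inversely proportional to sqrt (det Y). *)
Lemma covering_ellipsoid_volume (R : realType) n m (X P : 'M[R]_n)
    (Phi : 'I_m -> 'cV[R]_n) F :
  (0 < n)%N -> posdefmx X -> P^T *m X *m P = 1%:M ->
  (forall j, exists i, Phi i = col j P) -> covering_ellipsoid Phi F ->
  F = ellipsoid X 0 \/ (volume (ellipsoid X 0) < volume F)%E.
Proof.
move=> n0 hX PXP PhiP [[Y [c [hY ->]]] sub].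
have inF j : ellipsoid Y c (col j P) /\ ellipsoid Y c (- col j P).
  by have [i <-] := PhiP j; split; apply: sub; apply: sub_gen_smallest;
    [left|right]; exists i.
have [[-> ->]|dYX] := ellipsoid_rigidity n0 PXP hY inF; first by left.
right; rewrite (volume_sublevel 0 1 hX) (volume_sublevel c 1 hY).
have dX := posdefmx_det_gt0 hX; have dY := posdefmx_det_gt0 hY.
have b0 := @volume_euclidean_ball_gt0 R n 1 ltr01.
have b1 := @volume_euclidean_ball_lty R n 1 ler01.
have bfin : volume (euclidean_ball 1 : set 'cV[R]_n) \is a fin_num.
  by rewrite ge0_fin_numE // ltW.
rewrite lte_pmul2r // lte_fin ltf_pV2 ?posrE ?sqrtr_gt0 //.
by rewrite ltr_sqrt.
Qed.

(** * The frame *)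

(** Each coordinate of x = A^-1 (A x) is controlled by the Cauchy-Schwarz
    inequality. *)
Lemma unitmx_lower_bound (R : realType) n (A : 'M[R]_n) : A \in unitmx ->
  exists2 a, 0 < a & forall x, a * dotv x x <= dotv (A *m x) (A *m x).
Proof.
move=> uA; pose B := (invmx A)^T; pose C := \sum_i dotv (col i B) (col i B).
have C0 : 0 <= C by apply: sumr_ge0 => i _; exact: dotv_ge0.
have C1 : 0 < 1 + C by rewrite ltr_wpDr.
exists (1 + C)^-1; first by rewrite invr_gt0.
move=> x; rewrite ler_pdivrMl //; set y := A *m x.
apply: (@le_trans _ _ (C * dotv y y)); last first.
  by rewrite mulrDl mul1r lerDr dotv_ge0.
rewrite mulr_suml; apply: ler_sum => i _.
have -> : x i 0 = dotv (col i B) y.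
  rewrite -[in LHS](mulKmx uA x) mxE.
  by apply: eq_bigr => k _; rewrite !mxE.
by rewrite -expr2 cauchy_schwarz_dotv.
Qed.

Lemma frame_of_columns (R : realType) n m (P : 'M[R]_n)
    (Phi : 'I_m -> 'cV[R]_n) : P \in unitmx -> unit_norm Phi ->
  (forall x, \sum_j dotv x (col j P) ^+ 2 <= \sum_i dotv x (Phi i) ^+ 2) ->
  frame Phi.
Proof.
move=> uP Phi1 PPhi.
have uPT : P^T \in unitmx by rewrite unitmx_tr.
have [a a0 aP] := unitmx_lower_bound uPT.
exists a, (a + m%:R); split => //; first by rewrite lerDl.
move=> x; rewrite norm2_sqr.
under eq_bigr do rewrite real_normK ?num_real //.
apply/andP; split.
  apply: le_trans (aP x) _; apply: le_trans (PPhi x).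
  rewrite le_eqVlt; apply/orP; left; apply/eqP.
  apply: eq_bigr => j _; rewrite -expr2; congr (_ ^+ 2).
  by rewrite mxE; apply: eq_bigr => k _; rewrite !mxE mulrC.
apply: (@le_trans _ _ (m%:R * dotv x x)); last first.
  by rewrite ler_wpM2r ?dotv_ge0 // lerDr ltW.
rewrite -[m in m%:R]card_ord mulr_natl -sumr_const; apply: ler_sum => i _.
apply: le_trans (cauchy_schwarz_dotv _ _) _.
by rewrite -(norm2_sqr (Phi i)) Phi1 expr1n mulr1.
Qed.

Theorem theorem2p13 (R : realType) (N M : nat) (hN : (0 < N)%N)
    (hNM : (N <= M)%N) (X : 'M[R]_N) (hX : posdefmx X)
    (htr : \tr (invmx X) = N%:R) :
  exists Phi : 'I_M -> 'cV[R]_N,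
    [/\ frame Phi, unit_norm Phi & is_minimal_ellipsoid Phi (ellipsoid X 0)].
Proof.
case: N hN hNM X hX htr => [//|N] _ hNM X hX htr.
have uX := posdefmx_unit hX.
have [P0 P0X] := posdefmx_orthonormal_basis hX.
have P0E : P0 *m P0^T = invmx X.
  have XPP : X *m (P0 *m P0^T) = 1%:M.
    by rewrite mulmxA; apply: mulmx1C; rewrite mulmxA.
  by rewrite -(mulKmx uX (P0 *m P0^T)) XPP mulmx1.
have trP0 : \tr (P0 *m P0^T) = N.+1%:R by rewrite P0E.
have [P [PE Pcol]] := unit_norm_columns trP0.
have PXP : P^T *m X *m P = 1%:M.
  by rewrite -mulmxA; apply: mulmx1C; rewrite -mulmxA PE P0E mulmxV.
have uP : P \in unitmx by have := mulmx1_unit PXP => -[_].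
(* [inord] sends the indices from N on to 0, so the first column is repeated. *)
pose Phi (i : 'I_M) := col (inord i : 'I_N.+1) P.
have Phi1 : unit_norm Phi by move=> i; rewrite /norm2 Pcol sqrtr1.
have PhiP j : Phi (widen_ord hNM j) = col j P by rewrite /Phi inord_val.
exists Phi; split => //.
  apply: (frame_of_columns uP) => // x.
  rewrite [leLHS](_ : _ = \sum_(j < N.+1) dotv x (Phi (widen_ord hNM j)) ^+ 2).
    rewrite -(big_ord_narrow hNM (F := fun i => dotv x (Phi i) ^+ 2)).
    rewrite [leRHS](bigID (fun i : 'I_M => (i < N.+1)%N)) /= lerDl.
    by apply: sumr_ge0 => i _; exact: sqr_ge0.
  by apply: eq_bigr => j _; rewrite PhiP.
have PX j : ellipsoid X 0 (col j P).
  rewrite /ellipsoid /= !subr0.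
  have -> : X *m col j P = col j (X *m P) by rewrite !colE mulmxA.
  by rewrite dotvC dotv_col mulmxA PXP mxE eqxx.
have Xcov : covering_ellipsoid Phi (ellipsoid X 0).
  split; first by exists X, 0.
  apply: smallest_sub; first exact: convex_set_ellipsoid0.
  move=> _ [[i _ <-]|[i _ <-]]; first exact: PX.
  exact/ellipsoid0N/PX.
have PhiP' j : exists i, Phi i = col j P by exists (widen_ord hNM j).
have key F := covering_ellipsoid_volume (F := F) (ltn0Sn N) hX PXP PhiP'.
split.
  split=> // F /key[->//|/ltW //].
move=> F [Fcov Fmin]; have [//|] := key F Fcov.
by rewrite ltNge Fmin.
Qed.
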